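(* Let $G$ be a finite group and let $H\leq A\leq G$. Suppose that $H$ is a perfect code of $G$. Then the following statements are equivalent: (a) $A$ is a perfect code of the pair $(G,H)$; (b) there exists an inverse-closed left transversal $X$ of $A$ in $G$ such that $XH=HX$; (c) for each $g\in G$, there exists an inverse-closed left transversal $Y$ of $A$ in $A\{g,g^{-1}\}A$ such that $Y$ is a left transversal of $H$ in $HYH$.
   Context: All groups and graphs are finite; graphs are undirected and simple. A subset $C$ of the vertex set $V$ of a graph is a perfect code in the graph if every vertex in $V\setminus C$ is adjacent to exactly one vertex of $C$. For a group $G$ and an inverse-closed subset $S\subseteq G\setminus\{e\}$, the Cayley graph $\mathrm{Cay}(G,S)$ has vertex set $G$ and edges $\{g,sg\}$ for $s\in S$, $g\in G$. A subset of $G$ is a perfect code of $G$ if it is a perfect code in some Cayley graph of $G$. For $H\leq G$ and an inverse-closed subset $U\subseteq G\setminus H$, the coset graph $\mathrm{Cos}(G,H,U)$ has as vertices the left cosets of $H$ in $G$, with $xH$ and $yH$ adjacent iff $x^{-1}y\in HUH$. For $H\leq A\leq G$, $A$ is a perfect code of the pair $(G,H)$ if there is a coset graph $\mathrm{Cos}(G,H,U)$ in which the set of left cosets of $H$ contained in $A$ is a perfect code. If $B$ is a union of left cosets of a subgroup $K$, a left transversal of $K$ in $B$ is a subset of $B$ containing exactly one element of each left coset of $K$ contained in $B$. A subset $X$ is inverse-closed if $X^{-1}=X$. *)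

(* Defs.v *)
From mathcomp Require Import all_boot all_fingroup.

Set Implicit Arguments.
Unset Strict Implicit.
Unset Printing Implicit Defensive.

Local Open Scope group_scope.

(* [C] is not required to be independent in the graph. *)
Definition perfect_code (T : finType) (V : {set T}) (adj : rel T) (C : {set T}) : bool :=
  (C \subset V) && [forall v in V :\: C, #|[set c in C | adj v c]| == 1%N].

Section Codes.

Variable gT : finGroupType.
Implicit Types A B C G H K S U X : {set gT}.

Definition inverse_closed X : bool := X^-1 == X.

(* The edges are the pairs {g, s * g}: connection elements act on the left. *)
Definition cayley_adj S : rel gT := [rel x y | [exists s in S, y == s * x]].

Definition group_perfect_code G C : Prop :=
  exists S : {set gT}, [/\ S \subset G :\ 1, inverse_closed S
                         & perfect_code G (cayley_adj S) C].

(* Whether x^-1 * y lies in H * U * H does not depend on the representatives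
   x, y when [H] is a group. *)
Definition coset_adj H U : rel {set gT} :=
  [rel P Q | [exists x, exists y,
     [&& P == x *: H, Q == y *: H & x^-1 * y \in H * U * H]]].

Definition pair_perfect_code G H A : Prop :=
  exists U : {set gT}, [/\ U \subset G :\: H, inverse_closed U
    & perfect_code (lcosets H G) (coset_adj H U)
                   [set P in lcosets H G | P \subset A]].

(* [is_transversal] includes [partition (lcosets K B) B], which for a group [K]
   says exactly that [B] is a union of left cosets of [K]. *)
Definition left_transversal K B X : bool := is_transversal X (lcosets K B) B.

End Codes.

(* Main.v *)
Require Import Defs.
From mathcomp Require Import all_boot all_fingroup.

Set Implicit Arguments.
Unset Strict Implicit.
Unset Printing Implicit Defensive.

Local Open Scope group_scope.

(** All three conditions say that there is an inverse-closed set [D], invariant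
    under multiplication by [H] on both sides, that meets each left coset of
    [A] in [G] in exactly one left coset of [H]: for (a) it is [HUH], with its
    part inside [A] replaced by [H]; for (b) it is [XH]; for (c) it is pieced
    together from the sets [HYH].  Since [H] is a perfect code of [G], it has an
    inverse-closed left transversal [T], and [T :&: D] turns (a) into (b). *)

Section PerfectCodes.

Variable gT : finGroupType.
Implicit Types (X : {set gT}) (A G H K : {group gT}).

(** * Inverse-closed sets and left transversals *)

Lemma memV_inverse_closed X x : inverse_closed X -> (x^-1 \in X) = (x \in X).
Proof. by move/eqP=> {2}<-; rewrite inE. Qed.

Lemma inverse_closedP X :
  reflect {in X, forall x, x^-1 \in X} (inverse_closed X).
Proof.
apply: (iffP idP) => [iX x xX | iX]; first by rewrite memV_inverse_closed.
apply/eqP/setP=> x; rewrite inE; apply/idP/idP => [/iX|/iX //].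
by rewrite invgK.
Qed.

Lemma inverse_closedI X Y :
  inverse_closed X -> inverse_closed Y -> inverse_closed (X :&: Y).
Proof. by rewrite /inverse_closed invIg => /eqP-> /eqP->. Qed.

Lemma inverse_closed_double_mul H X :
  inverse_closed X -> inverse_closed (H * X * H).
Proof.
by move/eqP=> iX; rewrite /inverse_closed !invMg iX invGid mulgA.
Qed.

Lemma inverse_closed_pair (g : gT) : inverse_closed [set g; g^-1].
Proof.
by apply/inverse_closedP=> x /set2P[]->; rewrite ?invgK !inE eqxx ?orbT.
Qed.

(** Left cosets of a group are nonempty and pairwise disjoint, so the partition condition reduces to
    stability of [B] under right multiplication by [K]. Meeting each coset exactly once splits into
    existence and uniqueness. *)
Lemma left_transversalP K (B X : {set gT}) :
  reflect [/\ {in B & K, forall b k, b * k \in B}, X \subset B,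
              {in B, forall b, exists2 x, x \in X & b^-1 * x \in K}
            & {in X &, forall x y, x^-1 * y \in K -> x = y}]
          (left_transversal K B X).
Proof.
apply: (iffP and3P) => [[/and3P[/eqP cB _ _] sXB /forall_inP X1]|].
  have lcB b : b \in B -> b *: K \in lcosets K B.
    by move=> bB; apply/lcosetsP; exists b.
  split=> //.
  - move=> b k bB kK; rewrite -cB; apply/bigcupP; exists (b *: K).
      exact: lcB.
    by rewrite mem_lcoset mulKg.
  - move=> b /lcB/X1/cards1P[x Ex].
    have : x \in X :&: b *: K by rewrite Ex set11.
    by rewrite inE mem_lcoset => /andP[]; exists x.
  move=> x y xX yX xyK.
  have /X1/cards1P[z Ez] := lcB x (subsetP sXB x xX).
  have : x \in [set z] by rewrite -Ez inE xX lcoset_refl.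
  have : y \in [set z] by rewrite -Ez inE yX mem_lcoset.
  by move=> /set1P-> /set1P->.
move=> [BK sXB exX uX]; split=> //; last first.
  apply/forall_inP=> _ /lcosetsP[b bB ->].
  have [x xX bxK] := exX b bB.
  apply/cards1P; exists x; apply/setP=> y; rewrite !inE mem_lcoset.
  apply/andP/eqP=> [[yX byK]|->//]; apply: uX => //.
  have -> : y^-1 * x = (b^-1 * y)^-1 * (b^-1 * x).
    by rewrite invMg invgK -mulgA mulKVg.
  by rewrite groupM ?groupV.
apply/and3P; split.
- apply/eqP/setP=> x; apply/bigcupP/idP=> [[_ /lcosetsP[b bB ->]]|xB].
    by case/lcosetP=> k kK ->; apply: BK.
  by exists (x *: K); rewrite ?lcoset_refl //; apply/lcosetsP; exists x.
- apply/trivIsetP=> _ _ /lcosetsP[b bB ->] /lcosetsP[c cB ->] neq.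
  apply/pred0P=> x /=; apply: contraNF neq => /andP[xb xc].
  by rewrite -(lcoset_eqP xb) -(lcoset_eqP xc).
apply/negP=> /lcosetsP[b _ /setP/(_ b)].
by rewrite lcoset_refl inE.
Qed.

(** * Perfect codes in Cayley graphs *)

(** If [s * g = c] is the neighbour in [H] of some [g] outside [H], then [s^-1] lies in [g *: H]. So
    the connection elements outside [H] represent the cosets other than [H], and [1] is added to
    represent [H]. *)
Lemma group_perfect_code_transversal G H :
  group_perfect_code G H ->
  exists2 T : {set gT}, inverse_closed T & left_transversal H G T.
Proof.
case=> S [/subsetP sSG iS /andP[/subsetP sHG /forall_inP code]].
have SG s : s \in S -> s \in G by move/sSG/setD1P=> [].
have Vcode v : v \in G -> v \notin H ->
    exists c, [set c in H | cayley_adj S v c] = [set c].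
  by move=> vG vH; apply/cards1P/code; rewrite inE vH.
exists (1 |: (S :\: H)).
  apply/inverse_closedP=> x; rewrite !inE invg_eq1 groupV.
  by rewrite memV_inverse_closed.
apply/left_transversalP; split.
- by move=> g h gG hH; rewrite groupM // sHG.
- apply/subsetP=> x; rewrite !inE => /predU1P[->|/andP[_ /SG //]].
  exact: group1.
- move=> g gG; have [gH | gH] := boolP (g \in H).
    by exists 1; rewrite ?setU11 // mulg1 groupV.
  have [c /setP/(_ c)] := Vcode g gG gH.
  rewrite set11 inE => /andP[cH /exists_inP[s sS /eqP cE]].
  have Es : s^-1 = g * c^-1 by rewrite cE invMg mulKVg.
  exists s^-1; last by rewrite Es mulKg groupV.
  rewrite !inE (memV_inverse_closed _ iS) sS andbT Es.
  by rewrite groupMr ?groupV // gH orbT.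
- move=> x y; rewrite !inE => /predU1P[->|/andP[xH xS]].
    by case/predU1P=> [//|/andP[yH _]]; rewrite invg1 mul1g (negPf yH).
  case/predU1P=> [->|/andP[yH yS] xyH].
    by rewrite mulg1 groupV (negPf xH).
  (* Both [x^-1 * x = 1] and [y^-1 * x] are neighbours of [x] in [H], so they coincide. *)
  have [c Ec] := Vcode x (SG _ xS) xH.
  have : 1 \in [set c].
    rewrite -Ec inE group1; apply/exists_inP; exists x^-1.
      by rewrite memV_inverse_closed.
    by rewrite mulVg.
  have : y^-1 * x \in [set c].
    rewrite -Ec inE -groupV invMg invgK xyH; apply/exists_inP; exists y^-1 => //.
    by rewrite memV_inverse_closed.
  by move=> /set1P<- /set1P/esym/eqP; rewrite -eq_mulVg1 => /eqP.
Qed.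

(** * Coset graphs and double cosets *)

(** For [g] outside [A], the map [y *: H] to [(g * y) *: H] sends the neighbours of [g^-1 *: H]
    inside [A] to the left cosets of [H] in the intersection of [g *: A] with [H * U * H]. A unique
    neighbour is thus a unique coset there. *)
Lemma pair_perfect_codeP G H A :
  H \subset A -> A \subset G ->
  pair_perfect_code G H A <->
  exists D : {set gT},
    [/\ inverse_closed D, D \subset G, D * H = D,
        {in G, forall g, exists2 d, d \in D & g^-1 * d \in A}
      & {in D &, forall x y, x^-1 * y \in A -> x^-1 * y \in H}].
Proof.
move=> sHA sAG; have [HA AG] := (subsetP sHA, subsetP sAG).
have lcG x : x \in G -> x *: H \in lcosets H G.
  by move=> xG; apply/lcosetsP; exists x.
have lcA x : (x *: H \subset A) = (x \in A).
  apply/idP/idP=> [/subsetP|xA]; first by apply; apply: lcoset_refl.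
  by rewrite mul_subG ?sub1set.
split=> [[U [sUG iU /andP[_ /forall_inP code]]]|[D [iD sDG DH exD uD]]].
  have UG : H * U * H \subset G.
    rewrite !mul_subG ?(subset_trans sHA) //.
    by apply: subset_trans sUG _; apply: subsetDl.
  have Vcode x : x \in G -> x \notin A ->
      exists P, [set P in [set P in lcosets H G | P \subset A]
                | coset_adj H U (x *: H) P] = [set P].
    move=> xG xA; apply/cards1P/code.
    by rewrite !inE lcG // lcA (negPf xA).
  (* The code condition only concerns vertices outside [A], so it says nothing on [H * U * H] inside
     [A]; [H] supplies the one coset required there. *)
  exists ((H * U * H) :\: A :|: H); split.
  - apply/inverse_closedP=> x; rewrite !inE !groupV.
    by rewrite memV_inverse_closed // inverse_closed_double_mul.
  - rewrite subUset (subset_trans sHA) // andbT.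
    by apply: subset_trans UG; apply: subsetDl.
  - apply/setP=> x; apply/mulsgP/idP=> [[d h dD hH ->]|xD]; last first.
      by exists x 1; rewrite ?mulg1.
    move: dD; rewrite !inE (groupMr _ hH) (groupMr _ (HA h hH)).
    case/orP=> [/andP[-> /mulsgP[u k uU kH ->]]|->]; last by rewrite orbT.
    by rewrite -mulgA mem_mulg // groupM.
  - move=> g gG; have [gA|gA] := boolP (g \in A).
      by exists 1; rewrite ?mulg1 ?groupV // inE [1 \in H]group1 orbT.
    have [||P /setP/(_ P)] := Vcode g^-1; rewrite ?groupV //.
    rewrite set11 inE => /andP[].
    rewrite inE => /andP[PG PA].
    move=> /existsP[x /existsP[y /and3P[/eqP gx /eqP Py xy]]].
    move: PA; rewrite Py lcA => yA.
    have /lcosetP[h hH gxh] : g^-1 \in x *: H by rewrite -gx lcoset_refl.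
    have gy : g * y = h^-1 * (x^-1 * y).
      by rewrite -[g]invgK gxh invMg mulgA.
    exists (g * y); last by rewrite mulKg.
    rewrite !inE groupMr // gA /= gy.
    case/mulsgP: xy => u k /mulsgP[h' u' h'H u'U ->] kH ->.
    by rewrite !mulgA !mem_mulg // groupM ?groupV.
  - move=> x y xD; have [xA|xA] := boolP (x \in A).
      move: xD; rewrite !inE xA /= => xH.
      move=> /orP[/andP[yA _]|yH _]; last by rewrite groupM ?groupV.
      by rewrite groupMl ?groupV // (negPf yA).
    move: xD; rewrite !inE (negPf xA) /= => /orP[xD|/HA xA']; last first.
      by rewrite xA' in xA.
    move=> yD xyA.
    have yA : y \notin A.
      by apply: contra xA => yA; rewrite -groupV -(groupMr _ yA).
    move: yD; rewrite (negPf yA) /= => /orP[yD|/HA yA']; last first.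
      by rewrite yA' in yA.
    have iUU := inverse_closed_double_mul H iU.
    (* The vertex [x^-1 *: H] is adjacent to [H] because [x] is in [H * U * H], and to
       [(x^-1 * y) *: H] because [y] is. Both lie in [A], hence are equal. *)
    have [||P EP] := Vcode x^-1; rewrite ?groupV ?(subsetP UG) //.
    have inP z : z \in A -> x * z \in H * U * H -> z *: H = P.
      move=> zA xz; apply/set1P; rewrite -EP !inE lcG ?AG // lcA zA.
      by apply/existsP; exists x^-1; apply/existsP; exists z; rewrite !eqxx invgK.
    have : (x^-1 * y) *: H = 1 *: H.
      by rewrite !inP ?mulKVg ?mulg1 ?group1.
    by move/lcoset_eqP; rewrite mul1g.
have HD : H * D = D.
  by rewrite -[in LHS](eqP iD) -{1}(invGid H) -invMg DH (eqP iD).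
(* An edge from a vertex outside [A] to one inside involves only elements outside [A], so discarding
   all of [D] inside [A] loses no relevant edge and keeps the connection set off [H]. *)
exists (D :\: A).
have HUH : H * (D :\: A) * H \subset D :\: A.
  apply/subsetP=> _ /mulsgP[_ k /mulsgP[h d hH /setDP[dD dA] ->] kH ->].
  rewrite inE (groupMr _ (HA k kH)) (groupMl _ (HA h hH)) dA /= -mulgA.
  by rewrite -HD mem_mulg // -DH mem_mulg.
split.
- apply: setDSS => //.
- by apply/inverse_closedP=> x; rewrite !inE groupV memV_inverse_closed.
apply/andP; split.
  by apply/subsetP=> P; rewrite inE => /andP[].
apply/forall_inP=> v /setDP[/lcosetsP[x xG ->]].
rewrite inE lcG // lcA /= => xA.
have [|d dD] := exD x^-1; rewrite ?groupV // invgK => xdA.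
have dA : d \notin A by apply: contra xA => dA; rewrite -(groupMr _ dA).
(* Since [d] represents [x^-1 *: A], the product [x * d] is in [A], and [x^-1 * (x * d) = d] gives
   the edge. *)
apply/cards1P; exists ((x * d) *: H).
apply/setP=> P; rewrite in_set in_set1 in_set; apply/idP/eqP=> [|->].
  case/andP=> /andP[_ PA].
  move=> /existsP[x' /existsP[y' /and3P[/eqP xx' /eqP Py]]].
  move/(subsetP HUH)/setDP=> [xyD _].
  rewrite Py lcA in PA.
  have /lcosetP[h hH xE] : x \in x' *: H by rewrite -xx' lcoset_refl.
  have xyD' : x^-1 * y' \in D.
    by rewrite xE invMg -mulgA -HD mem_mulg ?groupV.
  rewrite Py; apply/lcoset_eqP; rewrite mem_lcoset invMg -mulgA.
  by apply: uD; rewrite // mulgA -invMg groupM ?groupV.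
rewrite lcG ?AG // lcA xdA; apply/existsP; exists x; apply/existsP; exists (x * d).
rewrite !eqxx mulKg /= -[d]mulg1 -[d]mul1g !mem_mulg ?group1 //.
by rewrite inE dA.
Qed.

(** Lets the choice of [Y] in (c) depend only on the class of [g]. *)
Lemma double_coset_pair_eq A (g x : gT) :
  x \in A * [set g; g^-1] * A -> A * [set x; x^-1] * A = A * [set g; g^-1] * A.
Proof.
have AcA (a b z : gT) : a \in A -> b \in A -> A * [set a * z * b] * A = A * [set z] * A.
  move=> aA bA; rewrite -!mulg_set1 !mulgA (rcoset_id aA).
  by rewrite -(mulgA _ [set b]) (lcoset_id bA).
case/mulsgP=> _ b /mulsgP[a z aA zg ->] bA ->.
rewrite !mulgU !mulUg invMg invMg mulgA !AcA ?groupV //.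
by case/set2P: zg => ->; rewrite ?invgK // setUC.
Qed.

(** * The cycle of implications *)

Lemma pair_perfect_code_transversal G H A :
  H \subset A -> A \subset G -> group_perfect_code G H ->
  pair_perfect_code G H A ->
  exists X : {set gT},
    [/\ inverse_closed X, left_transversal A G X & X * H = H * X].
Proof.
move=> sHA sAG /group_perfect_code_transversal[T iT].
move=> /left_transversalP[_ sTG exT uT].
case/(pair_perfect_codeP sHA sAG)=> D [iD sDG DH exD uD].
have exTD d : d \in D -> exists2 t, t \in T :&: D & d^-1 * t \in H.
  move=> dD; have [t tT dtH] := exT d (subsetP sDG d dD).
  by exists t; rewrite // inE tT -DH -(mulKVg d t) mem_mulg.
have XH : (T :&: D) * H = D.
  apply/eqP; rewrite eqEsubset -{2}DH mulSg ?subsetIr //.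
  apply/subsetP=> d /exTD[t tX dtH]; rewrite -(mulKVg t d) mem_mulg //.
  by rewrite -groupV invMg invgK.
have iX := inverse_closedI iT iD.
exists (T :&: D); split=> //; last first.
  (* Inverting [(T :&: D) * H = D], where [T :&: D], [H] and [D] are all inverse-closed, gives
     [H * (T :&: D) = D]. *)
  by rewrite XH -(eqP iX) -{1}(invGid H) -invMg XH (eqP iD).
apply/left_transversalP; split.
- by move=> g a gG /(subsetP sAG); apply: groupM.
- by rewrite subIset // sTG.
- move=> g gG; have [d dD gdA] := exD g gG.
  have [t tX dtH] := exTD d dD; exists t => //.
  by rewrite -(mulKVg d t) mulgA groupM // (subsetP sHA).
- move=> x y /setIP[xT xD] /setIP[yT yD] xyA.
  by apply: uT => //; apply: uD.
Qed.

(** The set [B] is inverse-closed and stable under [A] on both sides, so [X :&: B] inherits the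
    properties of [X]. *)
Lemma transversal_double_coset G H A (X : {set gT}) (g : gT) :
  H \subset A -> A \subset G -> g \in G ->
  inverse_closed X -> left_transversal A G X -> X * H = H * X ->
  exists Y : {set gT},
    [/\ inverse_closed Y, left_transversal A (A * [set g; g^-1] * A) Y
      & left_transversal H (H * Y * H) Y].
Proof.
move=> sHA sAG gG iX /left_transversalP[_ sXG exX uX] XH.
set B := A * _ * A.
have BA : {in B & A, forall b a, b * a \in B}.
  move=> _ a /mulsgP[z b zg bA ->] aA.
  by rewrite -mulgA mem_mulg // groupM.
have AB : {in A & B, forall a b, a * b \in B}.
  move=> a _ aA /mulsgP[_ b /mulsgP[c z cA zg ->] bA ->].
  by rewrite !mulgA !mem_mulg // groupM.
have sBG : B \subset G.
  by rewrite !mul_subG // subUset !sub1set groupV gG.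
have iB : inverse_closed B by apply/inverse_closed_double_mul/inverse_closed_pair.
exists (X :&: B); split; first exact: inverse_closedI.
  apply/left_transversalP; split=> //.
  - exact: subsetIr.
  - move=> b bB; have [x xX bxA] := exX b (subsetP sBG b bB).
    by exists x; rewrite // inE xX -(mulKVg b x) BA.
  - by move=> x y /setIP[xX _] /setIP[yX _]; apply: uX.
apply/left_transversalP; split.
- move=> _ k /mulsgP[z h zH hH ->] kH.
  by rewrite -mulgA mem_mulg // groupM.
- apply/subsetP=> y yX; rewrite -[y]mulg1 -[y]mul1g.
  by rewrite !mem_mulg.
- move=> _ /mulsgP[_ k /mulsgP[h y hH /setIP[yX yB] ->] kH ->].
  (* Commutation rewrites [h * y] as [x * h']; this [x] represents the coset of [h * y * k] and
     stays in [B]. *)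
  have /mulsgP[x h' xX h'H hyE] : h * y \in X * H by rewrite XH mem_mulg.
  have xE : x = h * y * h'^-1 by rewrite hyE mulgK.
  exists x; last by rewrite hyE !invMg -!mulgA mulVg mulg1 groupM ?groupV.
  by rewrite inE xX xE BA ?AB ?groupV ?(subsetP sHA).
- move=> x y /setIP[xX _] /setIP[yX _] /(subsetP sHA); exact: uX.
Qed.

Lemma pair_perfect_code_double_cosets G H A :
  H \subset A -> A \subset G ->
  (forall g : gT, g \in G -> exists Y : {set gT},
     [/\ inverse_closed Y, left_transversal A (A * [set g; g^-1] * A) Y
       & left_transversal H (H * Y * H) Y]) ->
  pair_perfect_code G H A.
Proof.
move=> sHA sAG exY; apply/(pair_perfect_codeP sHA sAG).
pose good B (Y : {set gT}) := [&& inverse_closed Y, left_transversal A B Y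
                                & left_transversal H (H * Y * H) Y].
(* The choice is a function of the set, so elements generating the same set share one transversal;
   the default [set0] never occurs on [B g] with [g] in [G]. *)
pose F (B : {set gT}) := odflt set0 [pick Y | good B Y].
pose B (g : gT) := A * [set g; g^-1] * A.
have FP g : g \in G -> good (B g) (F (B g)).
  move=> gG; rewrite /F; case: pickP => //= noY.
  by have [Y /and3P gY] := exY g gG; have := noY Y; rewrite /good gY.
have BB g x : x \in B g -> B x = B g := @double_coset_pair_eq A g x.
have Bid g : g \in B g.
  by rewrite /B -{1}[g]mulg1 -{1}[g]mul1g !mem_mulg // set21.
pose Y := \bigcup_(g in G) F (B g).
have memY y : y \in Y -> y \in G /\ y \in F (B y).
  case/bigcupP=> g gG yF.
  have /and3P[_ /left_transversalP[_ sFB _ _] _] := FP g gG.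
  have yB := subsetP sFB y yF; split; last by rewrite (BB _ _ yB).
  apply: subsetP yB; rewrite !mul_subG // subUset !sub1set groupV gG //.
have iY : inverse_closed Y.
  apply/inverse_closedP=> x /bigcupP[g gG xF]; apply/bigcupP; exists g => //.
  by have /and3P[iF _ _] := FP g gG; rewrite memV_inverse_closed.
(* Each piece represents every left coset of [H] in its own [H]-double product. This makes [Y * H]
   inverse-closed, as [H * Y * H] is. *)
have HYH : H * Y * H = Y * H.
  apply/eqP; rewrite eqEsubset [X in _ && X]mulSg ?mulG_subr // andbT.
  apply/subsetP=> _ /mulsgP[_ k /mulsgP[h y hH /bigcupP[g gG yF] ->] kH ->].
  have /and3P[_ _ /left_transversalP[_ _ exF _]] := FP g gG.
  have [|x xF xH] := exF (h * y * k); first by rewrite !mem_mulg.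
  rewrite -(mulKVg x (h * y * k)) mem_mulg //; first by apply/bigcupP; exists g.
  by rewrite -groupV invMg invgK.
(* If [x^-1 * y] is in [A], then [y] lies in [B x], so [x] and [y] come from the same chosen
   transversal. *)
have uY : {in Y &, forall x y, x^-1 * y \in A -> x = y}.
  move=> x y /memY[xG xF] /memY[yG yF] xyA.
  have /and3P[_ /left_transversalP[BA _ _ uF] _] := FP x xG.
  apply: (uF) => //; rewrite -(BB x y) //.
  by rewrite -(mulKVg x y) BA ?Bid.
exists (Y * H); split.
- by rewrite -HYH inverse_closed_double_mul.
- rewrite mul_subG ?(subset_trans sHA) //.
  by apply/subsetP=> y /memY[].
- by rewrite -mulgA mulGid.
- move=> g gG; have /and3P[_ /left_transversalP[_ _ exF _] _] := FP g gG.
  have [y yF gyA] := exF g (Bid g); exists y => //.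
  by rewrite -[y]mulg1 mem_mulg //; apply/bigcupP; exists g.
move=> _ _ /mulsgP[x h xY hH ->] /mulsgP[y k yY kH ->].
have -> : (x * h)^-1 * (y * k) = h^-1 * (x^-1 * y) * k by rewrite invMg !mulgA.
have HA z : z \in H -> z \in A by apply: subsetP.
have hA : h^-1 \in A by rewrite HA ?groupV.
rewrite (groupMr _ (HA k kH)) (groupMl _ hA).
by move/(uY _ _ xY yY)=> ->; rewrite mulVg mulg1 groupM ?groupV.
Qed.

End PerfectCodes.

Theorem theorem1p6 (gT : finGroupType) (G H A : {group gT})
    (sHA : H \subset A) (sAG : A \subset G)
    (codeH : group_perfect_code G H) :
  [<-> (* (a) *) pair_perfect_code G H A;
       (* (b) *) exists X : {set gT},
                   [/\ inverse_closed X, left_transversal A G X & X * H = H * X];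
       (* (c) *) forall g : gT, g \in G ->
                   exists Y : {set gT},
                     [/\ inverse_closed Y,
                         left_transversal A (A * [set g; g^-1] * A) Y
                       & left_transversal H (H * Y * H) Y]].
Proof.
tfae.
- exact: pair_perfect_code_transversal.
- by case=> X [iX tX XH] g gG; apply: transversal_double_coset iX tX XH.
- exact: pair_perfect_code_double_cosets.
Qed.
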